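(* Let $k$ be a local field, let $\mathcal{M}$ be a topological monoid, and let $(V,\rho)$ be a finite dimensional strictly Cartesian unitary representation of $\mathcal{M}$ over $k$. Let $\mathcal{A}$ be the closure of the image of the group algebra $k[\mathcal{M}]$ under the $k$-linear extension of $\rho$ in the Banach $k$-algebra $\mathrm{B}_k(V)$ of continuous $k$-linear endomorphisms of $V$ with the operator norm. If $\overline{\mathcal{A}}$ is a semisimple $\bar k$-algebra, then $(V,\rho)$ is a semisimple representation of $\mathcal{M}$, i.e. $V$ is a direct sum of irreducible subrepresentations.
   Context: A local field is a complete discrete valuation field $k$ with finite residue field $\bar k$, equipped with a fixed non-Archimedean absolute value $|\cdot|$. A topological monoid is a monoid with a topology for which multiplication is continuous. A unitary representation of $\mathcal{M}$ over $k$ is a pair $(V,\rho)$ of a Banach $k$-vector space $V$ (complete, non-Archimedean norm with $\|cv\|=|c|\|v\|$) and a monoid homomorphism $\rho\colon \mathcal{M} \to \mathrm{End}_k(V)$ such that $\|\rho(m)v\| \le \|v\|$ for all $m, v$ and the action $\mathcal{M} \times V \to V$, $(m,v) \mapsto \rho(m)v$, is continuous; it is strictly Cartesian if $\{\|v\| : v \in V\} \subset \{|c| : c \in k\}$. The operator norm on $\mathrm{B}_k(V)$ is $\|T\| = \sup_{\|v\| \le 1}\|Tv\|$. For a Banach $k$-algebra $\mathcal{A}$, $\mathcal{A}(1) = \{a : \|a\|\le 1\}$, $\mathcal{A}(1-) = \{a : \|a\|<1\}$, and $\overline{\mathcal{A}} = \mathcal{A}(1)/\mathcal{A}(1-)$.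 A subrepresentation is an $\mathcal{M}$-stable $k$-subspace; irreducible means nonzero with no subrepresentations other than $0$ and itself. A ring is semisimple if its left regular module is a direct sum of simple submodules. *)

(* Defs.v *)
From HB Require Import structures.
From mathcomp Require Import all_boot all_order all_algebra finmap.
From mathcomp Require Import generic_quotient ring_quotient.
From mathcomp Require Import mathcomp_extra boolp classical_sets functions.
From mathcomp Require Import cardinality reals topology.

Set Implicit Arguments.
Unset Strict Implicit.
Unset Printing Implicit Defensive.

Import Order.TTheory GRing.Theory Num.Theory.

Local Open Scope classical_set_scope.
Local Open Scope ring_scope.

Section Semisimple.
(* [pzRingType] rather than [nzRingType]: the reduction of the closed image
   algebra is the zero ring when the representation space is zero. *)
Variable A : pzRingType.

Definition simple_submod (N : lmodType A) (S : {pred N}) : Prop :=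
  [/\ submod_closed S,
      exists2 x, x \in S & x != 0 &
      forall T : {pred N}, submod_closed T -> {subset T <= S} ->
        T =i pred1 0 \/ T =i S].

(* The index type is arbitrary, so sums are taken over finite subfamilies. *)
Definition semisimple_module (N : lmodType A) : Prop :=
  exists (I : eqType) (S : I -> {pred N}),
    [/\ forall i, simple_submod (S i),
        forall x : N, exists (s : seq I) (y : I -> N),
          (forall i, y i \in S i) /\ x = \sum_(i <- s) y i &
        forall (s : seq I) (y : I -> N),
          uniq s -> (forall i, y i \in S i) -> \sum_(i <- s) y i = 0 ->
          forall i, i \in s -> y i = 0].

Definition semisimple_ring : Prop := semisimple_module A^o.

End Semisimple.

HB.mixin Record isNANormed (R : realType) U
    of GRing.Zmodule U & PseudoMetric R U := {
  nanorm : U -> R;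
  nanorm_ge0 : forall x, 0 <= nanorm x;
  nanorm_eq0 : forall x, (nanorm x == 0) = (x == 0);
  nanormB_le : forall x y, nanorm (x - y) <= Num.max (nanorm x) (nanorm y);
  ball_nanorm : forall (x : U) (e : R) (y : U),
    ball x e y <-> nanorm (x - y) < e
}.

#[short(type="naZmodType")]
HB.structure Definition NAZmodule (R : realType) :=
  {U of GRing.Zmodule U & PseudoMetric R U & isNANormed R U}.

Arguments nanorm {R s} _.

HB.factory Record Zmodule_isNANormed (R : realType) U of GRing.Zmodule U := {
  norm : U -> R;
  norm_ge0 : forall x, 0 <= norm x;
  norm_eq0 : forall x, (norm x == 0) = (x == 0);
  normB_le : forall x y, norm (x - y) <= Num.max (norm x) (norm y)
}.

HB.builders Context R U of Zmodule_isNANormed R U.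

Let nball (x : U) (e : R) (y : U) : Prop := norm (x - y) < e.

HB.instance Definition _ := @hasNbhs.Build U (nbhs_ (entourage_ nball)).

Let norm0 : norm 0 = 0. Proof. by apply/eqP; rewrite norm_eq0. Qed.

Let normN x : norm (- x) = norm x.
Proof.
have h y : norm (- y) <= norm y.
  rewrite -[- y]add0r (le_trans (normB_le _ _))// norm0.
  by rewrite ge_max norm_ge0 lexx.
by apply/eqP; rewrite eq_le h /= -{1}[x]opprK h.
Qed.

Let nball_center x e : 0 < e -> nball x e x.
Proof. by rewrite /nball subrr norm0. Qed.

Let nball_sym x y e : nball x e y -> nball y e x.
Proof. by rewrite /nball -opprB normN. Qed.

Let nball_triangle x y z e1 e2 :
  nball x e1 y -> nball y e2 z -> nball x (e1 + e2) z.
Proof.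
rewrite /nball => h1 h2.
have e1_ge0 : 0 <= e1 by exact: le_trans (norm_ge0 _) (ltW h1).
have e2_ge0 : 0 <= e2 by exact: le_trans (norm_ge0 _) (ltW h2).
have -> : x - z = (x - y) - (z - y) by rewrite opprB addrA subrK.
apply: le_lt_trans (normB_le _ _) _; rewrite gt_max.
rewrite (lt_le_trans h1) ?lerDl// -opprB normN.
by rewrite (lt_le_trans h2) ?lerDr.
Qed.

HB.instance Definition _ := Nbhs_isPseudoMetric.Build R U
  erefl nball_center nball_sym nball_triangle erefl.

HB.instance Definition _ := isNANormed.Build R U
  norm_ge0 norm_eq0 normB_le (fun _ _ _ => iff_refl _).

HB.end.

Section NAZmoduleTheory.
Context {R : realType} {U : naZmodType R}.
Implicit Types x y : U.

Lemma nanorm0 : nanorm (0 : U) = 0.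
Proof. by apply/eqP; rewrite nanorm_eq0. Qed.

Lemma nanormN x : nanorm (- x) = nanorm x.
Proof.
have h y : nanorm (- y) <= nanorm y.
  rewrite -[- y]add0r (le_trans (nanormB_le _ _))// nanorm0.
  by rewrite ge_max nanorm_ge0 lexx.
by apply/eqP; rewrite eq_le h /= -{1}[x]opprK h.
Qed.

Lemma nanormD_le x y : nanorm (x + y) <= Num.max (nanorm x) (nanorm y).
Proof. by rewrite -{1}[y]opprK (le_trans (nanormB_le _ _))// nanormN. Qed.

End NAZmoduleTheory.

HB.mixin Record isNANormedRing (R : realType) A
    of GRing.PzRing A & NAZmodule R A := {
  nanormM_le : forall x y : A, nanorm (x * y) <= nanorm x * nanorm y;
  nanorm1_le1 : nanorm (1 : A) <= 1
}.

#[short(type="naRingType")]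
HB.structure Definition NARing (R : realType) :=
  {A of GRing.PzRing A & NAZmodule R A & isNANormedRing R A}.

Section UnitBall.
Context {R : realType} (A : naRingType R).

Definition in_unit_ball : {pred A} := [pred a | nanorm a <= 1].

Lemma in_unit_ball_subring : subring_closed in_unit_ball.
Proof.
split=> [|x y|x y]; rewrite !inE /=; first exact: nanorm1_le1.
- by move=> x1 y1; rewrite (le_trans (nanormB_le _ _))// ge_max x1.
- move=> x1 y1; rewrite (le_trans (nanormM_le _ _))//.
  by rewrite mulr_ile1 ?nanorm_ge0.
Qed.

HB.instance Definition _ :=
  GRing.isSubringClosed.Build A in_unit_ball in_unit_ball_subring.

Record unit_ball := UnitBall {
  unit_ball_val :> A;
  unit_ballP : unit_ball_val \in in_unit_ball
}.

HB.instance Definition _ := [isSub for unit_ball_val].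
HB.instance Definition _ := [Choice of unit_ball by <:].
HB.instance Definition _ := 
  GRing.SubChoice_isSubPzRing.Build A in_unit_ball unit_ball
    in_unit_ball_subring.

Lemma unit_ball_val0 : unit_ball_val 0 = 0. Proof. exact: (raddf0 val). Qed.
Lemma unit_ball_val1 : unit_ball_val 1 = 1. Proof. exact: (rmorph1 val). Qed.
Lemma unit_ball_valD : {morph unit_ball_val : x y / x + y}.
Proof. exact: (raddfD val). Qed.
Lemma unit_ball_valB : {morph unit_ball_val : x y / x - y}.
Proof. exact: (raddfB val). Qed.
Lemma unit_ball_valM : {morph unit_ball_val : x y / x * y}.
Proof. exact: (rmorphM val). Qed.

Definition in_open_ball : {pred unit_ball} :=
  [pred a : unit_ball | nanorm (unit_ball_val a) < 1].

Lemma in_open_ball_zmod : zmod_closed in_open_ball.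
Proof.
split=> [|x y]; rewrite !inE /= ?unit_ball_val0 ?nanorm0// => x1 y1.
by rewrite (le_lt_trans (nanormB_le _ _))// gt_max x1.
Qed.

HB.instance Definition _ :=
  GRing.isZmodClosed.Build unit_ball in_open_ball in_open_ball_zmod.

Lemma in_open_ballMl (x y : unit_ball) :
  y \in in_open_ball -> x * y \in in_open_ball.
Proof.
rewrite !inE /= => y1; apply: le_lt_trans (nanormM_le _ _) _.
have := unit_ballP x; rewrite inE /= => x1.
by rewrite (le_lt_trans _ y1)// ler_piMl ?nanorm_ge0.
Qed.

Lemma in_open_ballMr (x y : unit_ball) :
  x \in in_open_ball -> x * y \in in_open_ball.
Proof.
rewrite !inE /= => x1; apply: le_lt_trans (nanormM_le _ _) _.
have := unit_ballP y; rewrite inE /= => y1.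
by rewrite (le_lt_trans _ x1)// ler_piMr ?nanorm_ge0.
Qed.

Definition reduction : Type := Quotient.quot in_open_ball.

End UnitBall.

Section ReductionRing.
Context {R : realType} (A : naRingType R).
Local Notation O := (unit_ball A).
Local Notation Q := (reduction A).
Local Open Scope quotient_scope.

HB.instance Definition _ := GRing.Zmodule.on Q.

Let p (x : O) : Q := \pi_(Quotient.quot (@in_open_ball R A)) x.

Let pE x y : (p x = p y) <-> (x - y \in @in_open_ball R A).
Proof.
by rewrite /p (Quotient.idealrBE (@in_open_ball R A)); split=> /eqP.
Qed.

Let repK (x : Q) : p (repr x) = x. Proof. exact: reprK. Qed.

Let pD x y : p (x + y) = p x + p y.
Proof. by rewrite /p (raddfD (\pi_(Quotient.quot (@in_open_ball R A)))). Qed.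

Definition reduction_one : Q := \pi_(Quotient.quot (@in_open_ball R A)) 1.
Definition reduction_mul (x y : Q) : Q :=
  \pi_(Quotient.quot (@in_open_ball R A)) (repr x * repr y).

Let pM x y : reduction_mul (p x) (p y) = p (x * y).
Proof.
apply/pE.
set x' := repr (p x); set y' := repr (p y).
have hx : x' - x \in @in_open_ball R A by apply/pE; rewrite repK.
have hy : y' - y \in @in_open_ball R A by apply/pE; rewrite repK.
have -> : x' * y' - x * y = x' * (y' - y) + (x' - x) * y.
  by rewrite mulrBr mulrBl addrA subrK.
by apply: rpredD; [exact: in_open_ballMl|exact: in_open_ballMr].
Qed.

Let mulA : associative reduction_mul.
Proof. by move=> x y z; rewrite -[x]repK -[y]repK -[z]repK !pM mulrA. Qed.
Let mul1l : left_id reduction_one reduction_mul.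
Proof. by move=> x; rewrite -[x]repK [reduction_one]/(p 1) pM mul1r. Qed.
Let mul1r' : right_id reduction_one reduction_mul.
Proof. by move=> x; rewrite -[x]repK [reduction_one]/(p 1) pM mulr1. Qed.
Let mulDl : left_distributive reduction_mul +%R.
Proof.
by move=> x y z; rewrite -[x]repK -[y]repK -[z]repK -pD !pM -pD mulrDl.
Qed.
Let mulDr : right_distributive reduction_mul +%R.
Proof.
by move=> x y z; rewrite -[x]repK -[y]repK -[z]repK -pD !pM -pD mulrDr.
Qed.

HB.instance Definition _ := GRing.Zmodule_isPzRing.Build Q
  mulA mul1l mul1r' mulDl mulDr.

Definition reduction_map : O -> Q := \pi_(Quotient.quot (@in_open_ball R A)).

Lemma reduction_mapD x y :
  reduction_map (x + y) = reduction_map x + reduction_map y.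
Proof. exact: pD. Qed.

Lemma reduction_mapM x y :
  reduction_map (x * y) = reduction_map x * reduction_map y.
Proof. by rewrite -[RHS]/(reduction_mul _ _) pM. Qed.

Lemma reduction_map1 : reduction_map 1 = 1. Proof. by []. Qed.

Lemma reduction_map_surj x : exists a, reduction_map a = x.
Proof. by exists (repr x); exact: repK. Qed.

Lemma reduction_map_eq x y :
  reduction_map x = reduction_map y <-> nanorm (unit_ball_val x - unit_ball_val y) < 1.
Proof.
split=> [/pE|h]; first by rewrite inE.
by apply/pE; rewrite inE.
Qed.

End ReductionRing.

HB.structure Definition CompleteNAZmodule (R : realType) :=
  {U of NAZmodule R U & CompletePseudoMetric R U}.

(* The value group is the infinite cyclic group generated by [nanorm pi]. *)
HB.mixin Record isLocalField (R : realType) K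
    of GRing.Field K & NARing R K := {
  absM : forall x y : K, nanorm (x * y) = nanorm x * nanorm y;
  abs_discrete : exists pi : K, 0 < nanorm pi < 1 /\
    (forall x : K, x != 0 -> exists n : int, nanorm x = nanorm pi ^ n);
  residue_finite : finite_set [set: reduction K]
}.

#[short(type="localFieldType")]
HB.structure Definition LocalField (R : realType) :=
  {K of GRing.Field K & CompleteNAZmodule R K & NARing R K
      & isLocalField R K}.

HB.mixin Record isNABanach (R : realType) (K : localFieldType R) V
    of GRing.Lmodule K V & NAZmodule R V := {
  nanormZ : forall (c : K) (v : V), nanorm (c *: v) = nanorm c * nanorm v
}.

#[short(type="banachType")]
HB.structure Definition NABanach (R : realType) (K : localFieldType R) :=
  {V of GRing.Lmodule K V & CompleteNAZmodule R V
      & isNABanach R K V}.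

#[short(type="finBanachType")]
HB.structure Definition FinNABanach (R : realType) (K : localFieldType R) :=
  {V of Vector K V & NABanach R K V}.

HB.mixin Record isStrictlyCartesian (R : realType) (K : localFieldType R) V
    of NABanach R K V := {
  strictly_cartesian : forall v : V, exists c : K, nanorm v = nanorm c
}.

#[short(type="cartFinBanachType")]
HB.structure Definition CartFinNABanach (R : realType) (K : localFieldType R) :=
  {V of FinNABanach R K V & isStrictlyCartesian R K V}.

Section ContinuousEnd.
Context {R : realType} {K : localFieldType R} (V : finBanachType K).

Definition is_cont_end : {pred 'End(V)} :=
  [pred T : 'End(V) | `[< continuous (T : V -> V) >]].

Record cont_end := ContEnd {
  cont_end_val :> 'End(V);
  cont_endP : cont_end_val \in is_cont_end
}.

Definition opnorm (T : cont_end) : R :=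
  sup [set nanorm (cont_end_val T v) | v in [set v : V | nanorm v <= 1]].

Lemma is_cont_endP (T : 'End(V)) :
  reflect (forall v e, 0 < e -> exists2 d, 0 < d &
             forall w, nanorm (v - w) < d -> nanorm (T v - T w) < e)
          (T \in is_cont_end).
Proof.
apply: (iffP (asboolP _)) => [cT v e e0|cT v].
  have /cvg_ballP/(_ e e0)/nbhs_ballP[d /= d0 dP] := cT v.
  by exists d => // w vw; apply/ball_nanorm; apply: dP; apply/ball_nanorm.
apply/cvg_ballP => e e0; have [d d0 dP] := cT v e e0.
apply/nbhs_ballP; exists d => //= w /ball_nanorm vw.
by apply/ball_nanorm; exact: dP.
Qed.

Lemma is_cont_end_subsemimod : subsemimod_closed is_cont_end.
Proof.
split; first split.
- apply/is_cont_endP => v e e0; exists 1 => // w _.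
  by rewrite !lfunE /= subr0 nanorm0.
- move=> S T /is_cont_endP cS /is_cont_endP cT; apply/is_cont_endP => v e e0.
  have [d1 d10 h1] := cS v e e0; have [d2 d20 h2] := cT v e e0.
  exists (Num.min d1 d2); first by rewrite lt_min d10.
  move=> w; rewrite lt_min => /andP[w1 w2]; rewrite !lfunE /= opprD addrACA.
  by rewrite (le_lt_trans (nanormD_le _ _))// gt_max h1// h2.
- move=> c T /is_cont_endP cT; apply/is_cont_endP => v e e0.
  have c1 : 0 < nanorm c + 1 by rewrite ltr_wpDl ?nanorm_ge0.
  have [d d0 h] := cT v (e / (nanorm c + 1)) (divr_gt0 e0 c1).
  exists d => // w /h; rewrite !lfunE /= -scalerBr nanormZ.
  rewrite ltr_pdivlMr// => /(le_lt_trans _); apply.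
  by rewrite mulrC ler_wpM2l ?nanorm_ge0// lerDl.
Qed.

HB.instance Definition _ := [isSub for cont_end_val].
HB.instance Definition _ := [Choice of cont_end by <:].
HB.instance Definition _ := GRing.SubChoice_isSubLmodule.Build K 'End(V)
  is_cont_end cont_end is_cont_end_subsemimod.

Lemma cont_end_val0 : cont_end_val 0 = 0. Proof. exact: (raddf0 val). Qed.
Lemma cont_end_valD : {morph cont_end_val : x y / x + y}.
Proof. exact: (raddfD val). Qed.
Lemma cont_end_valB : {morph cont_end_val : x y / x - y}.
Proof. exact: (raddfB val). Qed.
Lemma cont_end_valZ c : {morph cont_end_val : x / c *: x}.
Proof. exact: (linearZ_LR val). Qed.

Lemma cont_end_id_subproof : (\1%VF : 'End(V)) \in is_cont_end.
Proof.
by apply/is_cont_endP => v e e0; exists e => // w; rewrite !lfunE.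
Qed.

Lemma cont_end_comp_subproof (S T : cont_end) : (S \o T)%VF \in is_cont_end.
Proof.
apply/is_cont_endP => v e e0.
have /is_cont_endP/(_ (T v) e e0)[d d0 hS] := cont_endP S.
have /is_cont_endP/(_ v d d0)[d' d'0 hT] := cont_endP T.
by exists d' => // w /hT/hS; rewrite !lfunE.
Qed.

Definition cont_end_one := ContEnd cont_end_id_subproof.
Definition cont_end_mul (S T : cont_end) :=
  ContEnd (cont_end_comp_subproof S T).

Let mulA : associative cont_end_mul.
Proof. by move=> x y z; apply: val_inj; rewrite /= comp_lfunA. Qed.
Let mul1l : left_id cont_end_one cont_end_mul.
Proof. by move=> x; apply: val_inj; rewrite /= comp_lfun1l. Qed.
Let mul1r' : right_id cont_end_one cont_end_mul.
Proof. by move=> x; apply: val_inj; rewrite /= comp_lfun1r. Qed.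
Let mulDl : left_distributive cont_end_mul +%R.
Proof. by move=> x y z; apply: val_inj; rewrite /= comp_lfunDl. Qed.
Let mulDr : right_distributive cont_end_mul +%R.
Proof. by move=> x y z; apply: val_inj; rewrite /= comp_lfunDr. Qed.

HB.instance Definition _ := GRing.Zmodule_isPzRing.Build cont_end
  mulA mul1l mul1r' mulDl mulDr.

Lemma cont_end_val1 : cont_end_val 1 = \1%VF. Proof. by []. Qed.
Lemma cont_end_valM S T : cont_end_val (S * T) = (S \o T)%VF.
Proof. by []. Qed.

End ContinuousEnd.

(* Submultiplicativity of [opnorm] (hence [{T | opnorm T < 1}] being an
   ideal of the unit ball) relies on the norm of V taking its values in |k|:
   for norms with other values the supremum over the unit ball only bounds
   |T v| on vectors whose norm lies in |k|. *)
Section OperatorNorm.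
Context {R : realType} {K : localFieldType R}.

Lemma nanormK1 : nanorm (1 : K) = 1.
Proof.
have h : nanorm (1 : K) != 0 by rewrite nanorm_eq0 oner_eq0.
by apply: (mulfI h); rewrite mulr1 -absM mulr1.
Qed.

Lemma nanormKV (c : K) : c != 0 -> nanorm c^-1 = (nanorm c)^-1.
Proof.
move=> c0; have h : nanorm c != 0 by rewrite nanorm_eq0.
by apply: (mulfI h); rewrite -absM mulfV// nanormK1 mulfV.
Qed.

Lemma small_scalar (e : R) : 0 < e -> exists2 c : K, c != 0 & nanorm c < e.
Proof.
move=> e0; have [pi [/andP[p0 p1] _]] := @abs_discrete R K.
have pX n : nanorm (pi ^+ n) = nanorm pi ^+ n.
  by elim: n => [|n IHn]; rewrite ?expr0 ?nanormK1// !exprS absM IHn.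
have pi0 : pi != 0 by rewrite -nanorm_eq0 gt_eqF.
pose r := (nanorm pi)^-1; pose q := r - 1.
have q0 : 0 < q by rewrite subr_gt0 invf_gt1.
have bern n : 1 + q *+ n <= r ^+ n.
  elim: n => [|n IHn]; first by rewrite mulr0n addr0 expr0.
  have r0 : 0 <= r by rewrite invr_ge0 ltW.
  rewrite exprS; apply: le_trans (ler_wpM2l r0 IHn).
  have -> : r = q + 1 by rewrite subrK.
  rewrite mulrDl mul1r mulrDr mulr1 mulrS [leRHS]addrCA lerD2l.
  by rewrite lerD2r lerDl; apply: mulr_ge0; rewrite ?mulrn_wge0// ltW.
have [n hn] : exists n : nat, e^-1 < q *+ n.
  have e1 : 0 <= e^-1 / q by rewrite divr_ge0// ?invr_ge0 ltW.
  exists (Num.bound (e^-1 / q)).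
  by rewrite -mulr_natr mulrC -ltr_pdivrMr// archi_boundP.
exists (pi ^+ n); first by rewrite expf_neq0.
rewrite pX -[e]invrK -[_ ^+ n]invrK -exprVn.
rewrite ltf_pV2 ?posrE ?exprn_gt0 ?invr_gt0//.
by rewrite (lt_le_trans hn)// (le_trans _ (bern n))// lerDr.
Qed.

Variable V : cartFinBanachType K.
Implicit Types S T : cont_end V.

Local Notation opset T :=
  [set nanorm (cont_end_val T v) | v in [set v : V | nanorm v <= 1]].

Lemma opset_has_sup T : has_sup (opset T).
Proof.
split; first by exists (nanorm (T 0)), 0 => //=; rewrite nanorm0.
have /is_cont_endP/(_ 0 1 ltr01)[d d0 hT] := cont_endP T.
have [c c0 cd] := small_scalar d0.
have nc0 : 0 < nanorm c by rewrite lt0r nanorm_eq0 c0 nanorm_ge0.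
exists (nanorm c)^-1 => _ [v /= v1 <-].
have /hT : nanorm (0 - c *: v) < d.
  rewrite sub0r nanormN nanormZ (le_lt_trans _ cd)//.
  by rewrite ler_piMr ?nanorm_ge0.
rewrite linear0 sub0r nanormN linearZ /= nanormZ => /ltW.
by rewrite -ler_pdivlMl// mulr1.
Qed.

Lemma opnorm_le1 T v : nanorm v <= 1 -> nanorm (T v) <= opnorm T.
Proof. by move=> v1; apply: sup_upper_bound (opset_has_sup T) _ _; exists v. Qed.

Lemma opnorm_ge0 T : 0 <= opnorm T.
Proof.
by apply: le_trans (opnorm_le1 T (v := 0) _); rewrite ?nanorm_ge0 ?nanorm0.
Qed.

Lemma opnorm_le T v : nanorm (T v) <= opnorm T * nanorm v.
Proof.
have [->|v0] := eqVneq v 0; first by rewrite linear0 !nanorm0 mulr0.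
have [c cv] := @strictly_cartesian R K V v.
have c0 : c != 0 by rewrite -nanorm_eq0 -cv nanorm_eq0.
have nc0 : 0 < nanorm c by rewrite lt0r nanorm_eq0 c0 nanorm_ge0.
have v1 : nanorm (c^-1 *: v) <= 1.
  by rewrite nanormZ nanormKV// cv mulVf// gt_eqF.
have := opnorm_le1 T v1; rewrite linearZ /= nanormZ nanormKV//.
by rewrite cv mulrC ler_pdivrMr.
Qed.

Lemma opnorm_lub T r :
  (forall v, nanorm v <= 1 -> nanorm (T v) <= r) -> opnorm T <= r.
Proof.
move=> h; apply: ge_sup; first by case: (opset_has_sup T).
by move=> _ [v /= v1 <-]; exact: h.
Qed.

Lemma opnorm_eq0 T : (opnorm T == 0) = (T == 0).
Proof.
apply/eqP/eqP => [h|->].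
  apply/val_inj/lfunP => v; rewrite [in RHS]lfunE /=; apply/eqP.
  by rewrite -nanorm_eq0 eq_le nanorm_ge0 andbT -(mul0r (nanorm v)) -h opnorm_le.
apply/le_anti; rewrite opnorm_ge0 andbT; apply: opnorm_lub => v _.
by rewrite cont_end_val0 lfunE /= nanorm0.
Qed.

Lemma opnormB_le S T : opnorm (S - T) <= Num.max (opnorm S) (opnorm T).
Proof.
apply: opnorm_lub => v v1; rewrite cont_end_valB add_lfunE opp_lfunE.
apply: le_trans (nanormB_le _ _) _.
by rewrite ge_max !le_max !opnorm_le1 ?orbT.
Qed.

HB.instance Definition _ := Zmodule_isNANormed.Build R (cont_end V)
  opnorm_ge0 opnorm_eq0 opnormB_le.

Lemma nanorm_cont_endE T : nanorm T = opnorm T. Proof. by []. Qed.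

Lemma opnormM_le S T : nanorm (S * T) <= nanorm S * nanorm T.
Proof.
apply: opnorm_lub => v v1; rewrite cont_end_valM lfunE /=.
by rewrite (le_trans (opnorm_le _ _))// ler_wpM2l ?opnorm_ge0// opnorm_le1.
Qed.

Lemma opnorm1_le1 : nanorm (1 : cont_end V) <= 1.
Proof. by apply: opnorm_lub => v v1; rewrite cont_end_val1 lfunE. Qed.

HB.instance Definition _ := isNANormedRing.Build R (cont_end V)
  opnormM_le opnorm1_le1.

Lemma opnormZ (c : K) T : nanorm (c *: T) = nanorm c * nanorm T.
Proof.
have le d S : nanorm (d *: S) <= nanorm d * nanorm S.
  apply: opnorm_lub => v v1; rewrite cont_end_valZ lfunE /= nanormZ.
  by rewrite ler_wpM2l ?nanorm_ge0// opnorm_le1.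
have [->|c0] := eqVneq c 0; first by rewrite scale0r !nanorm0 mul0r.
have nc0 : 0 < nanorm c by rewrite lt0r nanorm_eq0 c0 nanorm_ge0.
apply/le_anti; rewrite le /= -ler_pdivlMl// -nanormKV//.
by rewrite (le_trans _ (le _ _))// scalerA mulVf// scale1r.
Qed.

End OperatorNorm.

HB.mixin Record isTopologicalMonoid M of Monoid M & Topological M := {
  mulg_continuous : continuous (fun p : M * M => (p.1 * p.2)%g)
}.

#[short(type="topMonoidType")]
HB.structure Definition TopologicalMonoid :=
  {M of Monoid M & Topological M & isTopologicalMonoid M}.

Record unitary_rep (R : realType) (K : localFieldType R) (M : topMonoidType)
    (V : finBanachType K) := UnitaryRep {
  rep_fun :> M -> 'End(V);
  rep1 : rep_fun 1%g = \1%VF;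
  repM : forall m n, rep_fun (m * n)%g = (rep_fun m \o rep_fun n)%VF;
  rep_contraction : forall m v, nanorm (rep_fun m v) <= nanorm v;
  rep_continuous : continuous (fun p : M * V => rep_fun p.1 p.2)
}.

Section Representation.
Context {R : realType} {K : localFieldType R} {M : topMonoidType}.

Section Subrepresentations.
Context {V : finBanachType K} (rho : unitary_rep M V).

Definition subrep (W : {vspace V}) : Prop :=
  forall m, (rho m @: W <= W)%VS.

Definition irreducible_subrep (W : {vspace V}) : Prop :=
  [/\ subrep W, W != 0%VS &
      forall U : {vspace V}, subrep U -> (U <= W)%VS -> U = 0%VS \/ U = W].

(* In finite dimension a direct sum of nonzero subspaces is finite. *)
Definition semisimple_rep : Prop :=
  exists (n : nat) (W : 'I_n -> {vspace V}),
    [/\ forall i, irreducible_subrep (W i),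
        directv (\sum_i W i) &
        (\sum_i W i)%VS = fullv].

Lemma rep_cont_end_subproof m : rho m \in @is_cont_end R K V.
Proof.
apply/is_cont_endP => v e e0; exists e => // w.
by rewrite -linearB => /(le_lt_trans _); apply; exact: rep_contraction.
Qed.

Definition rep_cont m : cont_end V := ContEnd (rep_cont_end_subproof m).

(* The elements of k[M] are the finitely supported functions M -> k. *)
Definition rep_ext (f : {fsfun M -> K with 0}) : cont_end V :=
  \sum_(m <- finsupp f) f m *: rep_cont m.

End Subrepresentations.

Section ImageAlgebra.
Context {V : cartFinBanachType K} (rho : unitary_rep M V).

Definition in_image_closure : {pred cont_end V} :=
  [pred T | `[< closure (range (rep_ext rho)) T >]].

Record image_closure := ImageClosure {
  image_closure_val :> cont_end V;
  image_closureP : image_closure_val \in in_image_closure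
}.

Lemma rep_ext_sup (f : {fsfun M -> K with 0}) (X : {fset M}) :
  (finsupp f `<=` X)%fset ->
  rep_ext rho f = \sum_(m <- X) f m *: rep_cont rho m.
Proof.
move=> fX; rewrite /rep_ext; apply: big_fset_incl => // m _ mf.
by rewrite fsfun_dflt ?scale0r.
Qed.

Lemma range_rep_ext_cont m : range (rep_ext rho) (rep_cont rho m).
Proof.
exists [fsfun x in [fset m]%fset => (1 : K) | 0] => //.
rewrite (@rep_ext_sup _ [fset m]%fset); last exact: finsupp_sub.
by rewrite big_seq_fset1 fsfunE inE eqxx scale1r.
Qed.

Lemma range_rep_ext0 : range (rep_ext rho) 0.
Proof.
by exists [fsfun] => //; rewrite /rep_ext finsupp0 big_seq_fset0.
Qed.

Lemma range_rep_extDZ c S T : range (rep_ext rho) S ->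
  range (rep_ext rho) T -> range (rep_ext rho) (c *: S + T).
Proof.
move=> [f _ <-] [g _ <-]; pose X := (finsupp f `|` finsupp g)%fset.
exists [fsfun x in X => c * f x + g x | 0] => //.
rewrite (@rep_ext_sup _ X); last exact: finsupp_sub.
rewrite (@rep_ext_sup f X) ?fsubsetUl// (@rep_ext_sup g X) ?fsubsetUr//.
rewrite scaler_sumr -big_split /= !big_seq; apply: eq_bigr => m mX.
by rewrite fsfunE mX scalerDl scalerA.
Qed.

Lemma range_rep_ext_sum (I : Type) (s : seq I) (c : I -> K)
    (F : I -> cont_end V) : (forall i, range (rep_ext rho) (F i)) ->
  range (rep_ext rho) (\sum_(i <- s) c i *: F i).
Proof.
move=> FP; elim: s => [|i s IHs]; first by rewrite big_nil; exact: range_rep_ext0.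
by rewrite big_cons; exact: range_rep_extDZ.
Qed.

Lemma range_rep_extM S T : range (rep_ext rho) S ->
  range (rep_ext rho) T -> range (rep_ext rho) (S * T).
Proof.
move=> [f _ <-] [g _ <-]; rewrite {1}/rep_ext mulr_suml.
have AZl c (X Y : cont_end V) : (c *: X) * Y = c *: (X * Y).
  by apply: val_inj; rewrite /= comp_lfunZl.
have AZr c (X Y : cont_end V) : X * (c *: Y) = c *: (X * Y).
  by apply: val_inj; rewrite /= comp_lfunZr.
under eq_bigr do rewrite AZl.
apply: range_rep_ext_sum => m; rewrite /rep_ext mulr_sumr.
under eq_bigr do rewrite AZr.
apply: range_rep_ext_sum => n.
have -> : rep_cont rho m * rep_cont rho n = rep_cont rho (m * n)%g.
  by apply: val_inj; rewrite /= repM.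
exact: range_rep_ext_cont.
Qed.

Lemma in_image_closureP (T : cont_end V) :
  reflect (forall e, 0 < e ->
             exists2 S, range (rep_ext rho) S & nanorm (T - S) < e)
          (T \in in_image_closure).
Proof.
apply: (iffP (asboolP _)) => [cT e e0|h B /nbhs_ballP[e /= e0 eB]].
  have [S [rS /ball_nanorm TS]] := cT _ (nbhsx_ballx T e e0).
  by exists S.
by have [S rS TS] := h e e0; exists S; split => //; apply/eB/ball_nanorm.
Qed.

Lemma in_image_closure_subring : subring_closed in_image_closure.
Proof.
split=> [|S T /in_image_closureP hS /in_image_closureP hT|
          S T /in_image_closureP hS /in_image_closureP hT].
- apply/in_image_closureP => e e0; exists 1; last by rewrite subrr nanorm0.
  have -> : 1 = rep_cont rho 1%g by apply: val_inj; rewrite /= rep1.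
  exact: range_rep_ext_cont.
- apply/in_image_closureP => e e0.
  have [S' rS' SS'] := hS e e0; have [T' rT' TT'] := hT e e0.
  exists (S' - T').
    by rewrite addrC -scaleN1r; exact: range_rep_extDZ.
  have -> : S - T - (S' - T') = (S - S') - (T - T').
    by rewrite !opprB addrACA [RHS]addrACA [- T + _]addrC.
  by rewrite (le_lt_trans (nanormB_le _ _))// gt_max SS'.
- apply/in_image_closureP => e e0.
  have T1 : 0 < nanorm T + 1 by rewrite ltr_wpDl ?nanorm_ge0.
  have [S' rS' SS'] := hS _ (divr_gt0 e0 T1).
  have S1 : 0 < nanorm S' + 1 by rewrite ltr_wpDl ?nanorm_ge0.
  have [T' rT' TT'] := hT _ (divr_gt0 e0 S1).
  exists (S' * T'); first exact: range_rep_extM.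
  have -> : S * T - S' * T' = (S - S') * T + S' * (T - T').
    by rewrite mulrBl mulrBr addrA subrK.
  apply: le_lt_trans (nanormD_le _ _) _; rewrite gt_max; apply/andP; split.
    apply: le_lt_trans (nanormM_le _ _) _; move: SS'; rewrite ltr_pdivlMr//.
    by apply: le_lt_trans; rewrite ler_wpM2l ?nanorm_ge0// lerDl.
  apply: le_lt_trans (nanormM_le _ _) _; move: TT'; rewrite ltr_pdivlMr//.
  by apply: le_lt_trans; rewrite mulrC ler_wpM2l ?nanorm_ge0// lerDl.
Qed.

HB.instance Definition _ := [isSub for image_closure_val].
HB.instance Definition _ := [Choice of image_closure by <:].
HB.instance Definition _ := GRing.SubChoice_isSubPzRing.Build (cont_end V)
  in_image_closure image_closure in_image_closure_subring.

Lemma image_closure_val0 : image_closure_val 0 = 0.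
Proof. exact: (raddf0 val). Qed.
Lemma image_closure_val1 : image_closure_val 1 = 1.
Proof. exact: (rmorph1 val). Qed.
Lemma image_closure_valD : {morph image_closure_val : x y / x + y}.
Proof. exact: (raddfD val). Qed.
Lemma image_closure_valB : {morph image_closure_val : x y / x - y}.
Proof. exact: (raddfB val). Qed.
Lemma image_closure_valM : {morph image_closure_val : x y / x * y}.
Proof. exact: (rmorphM val). Qed.

Let icnorm (T : image_closure) : R := nanorm (image_closure_val T).

Let icnorm_ge0 T : 0 <= icnorm T. Proof. exact: nanorm_ge0. Qed.
Let icnorm_eq0 T : (icnorm T == 0) = (T == 0).
Proof. by rewrite /icnorm nanorm_eq0 -(inj_eq val_inj). Qed.
Let icnormB_le S T : icnorm (S - T) <= Num.max (icnorm S) (icnorm T).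
Proof. by rewrite /icnorm image_closure_valB nanormB_le. Qed.

HB.instance Definition _ := Zmodule_isNANormed.Build R image_closure
  icnorm_ge0 icnorm_eq0 icnormB_le.

Lemma nanorm_image_closureE (T : image_closure) :
  nanorm T = opnorm (image_closure_val T).
Proof. by []. Qed.

Let icnormM_le (S T : image_closure) : nanorm (S * T) <= nanorm S * nanorm T.
Proof.
by rewrite -[nanorm (S * T)]/(nanorm (image_closure_val _))
  image_closure_valM nanormM_le.
Qed.
Let icnorm1_le1 : nanorm (1 : image_closure) <= 1.
Proof. exact: (@nanorm1_le1 R (cont_end V)). Qed.

HB.instance Definition _ := isNANormedRing.Build R image_closure
  icnormM_le icnorm1_le1.

End ImageAlgebra.
End Representation.

(* Main.v *)
Require Import Defs.
From HB Require Import structures.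
From mathcomp Require Import all_boot all_order all_algebra.
From mathcomp Require Import boolp classical_sets.
From mathcomp Require Import reals topology.

(** The image B of k[M] in End(V) is semiprime: b B b = 0 forces b = 0.
    Indeed the norm of V takes its values in |k| and |k| is discrete, so a
    nonzero b in B can be scaled to norm 1.  Its reduction is then nonzero, and
    since a semisimple ring is semiprime, some a in the closure of B has
    b a b <> 0; an approximation of a in B does as well.

    By Brauer's lemma a minimal left ideal of the finite dimensional semiprime
    algebra B is generated by an idempotent e, so every left ideal L containing
    it splits as B e + L (1 - e).  Induction on dim L shows that L V lies in the
    sum of the irreducible subrepresentations; take L = B. *)

Set Implicit Arguments.
Unset Strict Implicit.
Unset Printing Implicit Defensive.

Import Order.TTheory GRing.Theory Num.Theory.

Local Open Scope ring_scope.

(** * Subspaces of a finite dimensional space given by predicates *)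

Section Subspaces.
Context {K : fieldType} {V : vectType K}.
Implicit Types (U W T : {vspace V}).

(** Among the subspaces all of whose vectors satisfy [P], one of largest dimension contains every
    such vector: adjoining a missing one would raise the dimension. *)
Lemma vspace_of_pred (P : V -> Prop) : P 0 ->
  (forall c u v, P u -> P v -> P (c *: u + v)) ->
  exists U, forall x, x \in U <-> P x.
Proof.
move=> P0 PL.
pose Q n := `[< exists2 U : {vspace V}, (forall x, x \in U -> P x)
                  & \dim U = n >].
have Qn : exists n, Q n.
  exists 0%N; apply/asboolP; exists 0%VS; last exact: dimv0.
  by move=> x; rewrite memv0 => /eqP->.
have Qb n : Q n -> (n <= \dim {:V})%N.
  by move=> /asboolP[U _ <-]; exact/dimvS/subvf.
case: (ex_maxnP Qn Qb) => n /asboolP[U UP dU] nmax.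
exists U => x; split=> [/UP//|Px]; apply: contrapT => /negP xU.
have : (\dim (<[x]> + U)%VS <= n)%N.
  apply: nmax; apply/asboolP; exists (<[x]> + U)%VS => //.
  by move=> _ /memv_addP[_ /vlineP[c ->] [u uU ->]]; apply: PL => //; exact: UP.
rewrite leqNgt => /negP; apply; rewrite -dU.
rewrite ltn_neqAle dimvS ?addvSr// andbT; apply: contra xU => /eqP e.
have /eqP -> : U == (<[x]> + U)%VS by rewrite eqEdim addvSr e leqnn.
by rewrite (subvP (addvSl _ _))// memv_line.
Qed.

Lemma exists_minimal_vspace (P : {vspace V} -> Prop) U : P U ->
  exists W, [/\ P W, (W <= U)%VS &
    forall T, P T -> (T <= W)%VS -> T = W].
Proof.
move=> PU; pose Q n := `[< exists W, [/\ P W, (W <= U)%VS & \dim W = n] >].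
have Qn : exists n, Q n by exists (\dim U); apply/asboolP; exists U.
case: (ex_minnP Qn) => n /asboolP[W [PW WU dW]] nmin.
exists W; split=> // T PT TW; apply/eqP; rewrite eqEdim TW dW; apply: nmin.
by apply/asboolP; exists T; split=> //; exact: subv_trans WU.
Qed.

Lemma vspace_neq0P U : U != 0%VS -> exists2 x, x \in U & x != 0.
Proof. by move=> U0; exists (vpick U); rewrite ?memv_pick ?vpick0. Qed.

End Subspaces.

Section ImagePreimage.
Context {K : fieldType} {V W : vectType K} (f : V -> W).
Hypothesis f_linear : forall c u v, f (c *: u + v) = c *: f u + f v.

Let f0 : f 0 = 0.
Proof. by have := f_linear (-1) 0 0; rewrite scaler0 addr0 scaleN1r addNr. Qed.

(** Taking [f] as a bare function with a linearity equation covers both right multiplications and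
    evaluation at a vector. *)
Lemma vspace_image (U : {vspace V}) :
  exists T : {vspace W}, forall z, z \in T <-> exists2 y, y \in U & z = f y.
Proof.
apply: vspace_of_pred => [|c _ _ [y yU ->] [z zU ->]].
  by exists 0; rewrite ?mem0v ?f0.
by exists (c *: y + z); rewrite ?f_linear// memvD ?memvZ.
Qed.

Lemma vspace_preimage (U : {vspace V}) (T : {vspace W}) :
  exists S : {vspace V}, forall y, y \in S <-> y \in U /\ f y \in T.
Proof.
apply: vspace_of_pred => [|c y z [yU yT] [zU zT]]; first by rewrite f0 !mem0v.
by rewrite f_linear !memvD ?memvZ.
Qed.

End ImagePreimage.

(** * Minimal left ideals and simple modules of a semiprime algebra of endomorphisms *)

Section SemiprimeAlgebra.
Context {K : fieldType} {V : vectType K} (A : {vspace 'End(V)}).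
Hypothesis A1 : \1%VF \in A.
Hypothesis AM : forall a b, a \in A -> b \in A -> (a \o b)%VF \in A.
Hypothesis A_semiprime : forall a, a \in A -> a != 0 ->
  exists2 b, b \in A & (a \o (b \o a))%VF != 0.

Let left_ideal (L : {vspace 'End(V)}) : Prop :=
  (L <= A)%VS /\ forall a y, a \in A -> y \in L -> (a \o y)%VF \in L.

Definition stable_under (U : {vspace V}) : Prop :=
  forall a u, a \in A -> u \in U -> a u \in U.

Definition simple_under (W : {vspace V}) : Prop :=
  [/\ stable_under W, W != 0%VS &
      forall U, stable_under U -> (U <= W)%VS -> U = 0%VS \/ U = W].

Let minimal_left_ideal (L : {vspace 'End(V)}) : Prop :=
  [/\ left_ideal L, L != 0%VS &
    forall T, left_ideal T -> (T <= L)%VS -> T = 0%VS \/ T = L].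

Lemma exists_minimal_left_ideal L : left_ideal L -> L != 0%VS ->
  exists2 L0, minimal_left_ideal L0 & (L0 <= L)%VS.
Proof.
move=> LL L0.
have [W [[WL W0] WU Wmin]] := exists_minimal_vspace
  (P := fun T => left_ideal T /\ T != 0%VS) (conj LL L0).
exists W => //; split=> // T TL TW.
by have [->|T0] := eqVneq T 0%VS; [left|right; exact: Wmin].
Qed.

(* Brauer's lemma *)
Lemma minimal_left_ideal_idempotent L : minimal_left_ideal L ->
  exists e, [/\ e \in L, e != 0 & (e \o e)%VF = e].
Proof.
move=> [[LA LM] L0 Lmin]; have [x xL x0] := vspace_neq0P L0.
have [b bA xbx] := A_semiprime (subvP LA _ xL) x0.
set y := (b \o x)%VF in xbx.
have yL : y \in L by exact: LM.
have comp_linear c (u v : 'End(V)) :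
    ((c *: u + v) \o y = c *: (u \o y) + (v \o y))%VF.
  by rewrite comp_lfunDl comp_lfunZl.
(* Right multiplication by [y] is a module map on [L] with image [Ly] and kernel [N]. Minimality
   will give [Ly = L], because [x y] is nonzero, and then [N = 0]. *)
have [Ly LyP] := vspace_image comp_linear L.
have [N NP] := vspace_preimage comp_linear L 0%VS.
have LyL : left_ideal Ly.
  split=> [|a _ aA /LyP[z zL ->]].
    by apply/subvP => _ /LyP[z zL ->]; apply: AM; exact: subvP LA _ _.
  by apply/LyP; exists (a \o z)%VF; rewrite ?comp_lfunA//; exact: LM.
have sLy : (Ly <= L)%VS.
  by apply/subvP => _ /LyP[z zL ->]; apply: LM => //; exact: subvP LA _ _.
have [Ly0|eLy] := Lmin _ LyL sLy.
  by case/eqP: xbx; apply/eqP; rewrite -memv0 -Ly0; apply/LyP; exists x.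
(* This [e] satisfies [y = e y]; hence [e] is not in the kernel [N], whereas [e e - e] is. *)
have /LyP[e eL ye] : y \in Ly by rewrite eLy.
have y0 : y != 0 by apply: contraNneq xbx => ->; rewrite comp_lfun0r.
have NL : left_ideal N.
  split=> [|a z aA /NP[zL zy]]; first by apply/subvP => z /NP[/(subvP LA)].
  apply/NP; split; first exact: LM.
  by move: zy; rewrite -comp_lfunA !memv0 => /eqP ->; rewrite comp_lfun0r.
have sN : (N <= L)%VS by apply/subvP => z /NP[].
have [N0|NE] := Lmin _ NL sN; last first.
  have /NP[_] : e \in N by rewrite NE.
  by rewrite -ye memv0 (negPf y0).
exists e; split=> //.
  by apply: contraNneq y0 => e0; rewrite ye e0 comp_lfun0l.
apply/eqP; rewrite -subr_eq0 -memv0 -N0; apply/NP; split.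
  by rewrite memvB// LM// (subvP LA).
by rewrite comp_lfunDl comp_lfunNl -comp_lfunA -!ye subrr memv0.
Qed.

(** Evaluation at [v] maps [L] onto [W], so a stable subspace of [W] pulls back to a left ideal
    inside [L], which is zero or [L]. *)
Lemma minimal_left_ideal_orbit L v (W : {vspace V}) : minimal_left_ideal L ->
  (forall z, z \in W <-> exists2 y : 'End(V), y \in L & z = y v) ->
  W != 0%VS -> simple_under W.
Proof.
move=> [[LA LM] L0 Lmin] WP W0.
have Wst : stable_under W.
  move=> a _ aA /WP[y yL ->]; apply/WP; exists (a \o y)%VF; first exact: LM.
  by rewrite comp_lfunE.
split=> // U Ust UW.
have eval_linear c (f g : 'End(V)) : (c *: f + g) v = c *: f v + g v.
  by rewrite add_lfunE scale_lfunE.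
have [T TP] := vspace_preimage eval_linear L U.
have TL : left_ideal T.
  split=> [|a y aA /TP[yL yv]]; first by apply/subvP => y /TP[/(subvP LA)].
  by apply/TP; split; [exact: LM|rewrite comp_lfunE; exact: Ust].
have [T0|TE] : T = 0%VS \/ T = L.
- by apply: Lmin => //; apply/subvP => y /TP[].
- left; apply/eqP; rewrite -subv0; apply/subvP => u uU.
  have /WP[y yL uE] := subvP UW _ uU.
  have : y \in T by apply/TP; rewrite -uE.
  by rewrite T0 [y \in _]memv0 => /eqP y0; rewrite uE y0 zero_lfunE mem0v.
- right; apply/eqP; rewrite eqEsubv UW; apply/subvP => _ /WP[y yL ->].
  by have /TP[] : y \in T by rewrite TE.
Qed.

Lemma stable_containing_simples U : stable_under U ->
  (forall W, simple_under W -> (W <= U)%VS) -> U = fullv.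
Proof.
move=> Ust simU.
suff LU n L : (\dim L < n)%N -> left_ideal L ->
    forall (y : 'End(V)) v, y \in L -> y v \in U.
  apply/eqP; rewrite eqEsubv subvf; apply/subvP => v _.
  have := LU _ A (ltnSn _) (conj (subvv _) AM) _ v A1.
  by rewrite id_lfunE.
elim: n L => // n IHn L; rewrite ltnS => dL LL y v yL.
have [L0|L0] := eqVneq L 0%VS.
  by move: yL; rewrite L0 memv0 => /eqP->; rewrite zero_lfunE mem0v.
have [L' mL' sL'] := exists_minimal_left_ideal LL L0.
have [e [eL' e0 ee]] := minimal_left_ideal_idempotent mL'.
have [[L'A L'M] _ _] := mL'; have [LA LM] := LL.
have peirce_linear c (f g : 'End(V)) : (c *: f + g - ((c *: f + g) \o e) =
    c *: (f - (f \o e)) + (g - (g \o e)))%VF.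
  by rewrite comp_lfunDl -comp_lfunZl scalerBr opprD addrACA.
(* [T] is the Peirce complement [L (1 - e)]. *)
have [T TP] := vspace_image peirce_linear L.
have sTL : (T <= L)%VS.
  apply/subvP => _ /TP[z zL ->]; rewrite memvB//.
  by rewrite LM ?(subvP LA)// (subvP sL').
have TL : left_ideal T.
  split=> [|a _ aA /TP[z zL ->]]; first exact: subv_trans LA.
  apply/TP; exists (a \o z)%VF; first exact: LM.
  by rewrite comp_lfunDr comp_lfunNr comp_lfunA.
(* If [T] were [L], then [e = z (1 - e)] for some [z], and right multiplication by [e] would give
   [e = 0]. *)
have dT : (\dim T < n)%N.
  apply: leq_trans dL; rewrite ltn_neqAle dimvS// andbT.
  apply: contra e0 => /eqP dTL.
  have /eqP TE : T == L by rewrite eqEdim sTL dTL leqnn.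
  have /TP[z _ ez] : e \in T by rewrite TE (subvP sL').
  by rewrite -ee {1}ez comp_lfunDl comp_lfunNl -comp_lfunA ee subrr.
(* The first term lies in [L' v], which is zero or simple; the second is left to the induction
   hypothesis for [T]. *)
have -> : y v = (y \o e)%VF v + (y - (y \o e))%VF v.
  by rewrite add_lfunE opp_lfunE addrC subrK.
apply: memvD; last by apply: (IHn T) => //; apply/TP; exists y.
have eval_linear c (f g : 'End(V)) : (c *: f + g) v = c *: f v + g v.
  by rewrite add_lfunE scale_lfunE.
have [W WP] := vspace_image eval_linear L'.
suff /subvP : (W <= U)%VS.
  by apply; apply/WP; exists (y \o e)%VF => //; rewrite L'M// (subvP LA).
have [->|W0] := eqVneq W 0%VS; first exact: sub0v.
exact/simU/(minimal_left_ideal_orbit mL' WP).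
Qed.

End SemiprimeAlgebra.

(** * Semiprimeness of semisimple rings, lifted along the reduction *)

(** The unit is a sum of elements of simple left ideals, so [x] vanishes once left multiplication by
    it kills each of them. *)
Lemma semisimple_ring_semiprime (A : pzRingType) (x : A) :
  semisimple_ring A -> (forall r, x * r * x = 0) -> x = 0.
Proof.
move=> [I [S [simS spanS _]]] xAx.
suff xS i y : y \in S i -> x * y = 0.
  have [s [y [yS e1]]] := spanS 1.
  by rewrite -[x]mulr1 e1 mulr_sumr big1// => i _; exact: xS.
have [[S0 SL] _ Smin] := simS i.
(* By simplicity of [S i] this submodule is [0], and then it contains
   [x * y], or it is [S i], and then it contains [y]. *)
pose T : {pred A^o} :=
  [pred z | (z \in S i) && `[< forall r : A, x * r * z = 0 >]].
have TP z : z \in T <-> z \in S i /\ forall r : A, x * r * z = 0.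
  split=> [/andP[? /asboolP]|[zS zT]]; first by split.
  by apply/andP; split=> //; apply/asboolP.
have Tsub : submod_closed T.
  split=> [|c u v /TP[uS uT] /TP[vS vT]].
    by apply/TP; split=> // r; rewrite mulr0.
  apply/TP; split=> [|r]; first exact: SL.
  by rewrite mulrDr vT addr0 [c *: u]/(c * u) mulrA -[x * r * c]mulrA uT.
move=> yS; have [T0|TE] : T =i pred1 0 \/ T =i S i.
- by apply: Smin => // z /TP[].
- have : x * y \in T.
    apply/TP; split=> [|r]; last by rewrite mulrA xAx mul0r.
    by have := SL x y 0 yS S0; rewrite addr0.
  by rewrite T0 => /eqP.
- have /TP[_ /(_ 1)] : y \in T by rewrite TE.
  by rewrite mulr1.
Qed.

(** Norm exactly 1 places [a] in the unit ball with nonzero reduction, and every element of the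
    reduction lifts to some [b]. *)
Lemma reduction_semiprime (R : realType) (A : naRingType R) (a : A) :
  semisimple_ring (reduction A) -> nanorm a = 1 -> exists b, a * b * a != 0.
Proof.
move=> ssA a1; have aP : a \in @in_unit_ball R A by rewrite inE a1.
pose a' : unit_ball A := UnitBall aP.
have red0 : reduction_map (0 : unit_ball A) = 0.
  by apply: (addrI (reduction_map 0)); rewrite -reduction_mapD !addr0.
have ra : reduction_map a' != 0.
  rewrite -red0; apply/eqP => /reduction_map_eq.
  by rewrite unit_ball_val0 subr0 /= a1 ltxx.
apply: contrapT => h; case/eqP: ra.
apply: (semisimple_ring_semiprime ssA) => r.
have [b <-] := reduction_map_surj r.
rewrite -(reduction_mapM a' b) -(reduction_mapM (a' * b) a').
rewrite -red0; congr reduction_map; apply: val_inj => /=.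
by apply: contrapT => /eqP aba; apply: h; exists (unit_ball_val b).
Qed.

(** * Scaling operators to norm 1 *)

Section NormalizedOperator.
Context {R : realType} {K : localFieldType R} {V : cartFinBanachType K}.
Implicit Types T : cont_end V.

(** By discreteness no value of |k| lies strictly between 1 and the inverse of the norm of [pi]. *)
Lemma nanormK_gap : exists2 q : R, 1 < q &
  forall c : K, nanorm c < q -> nanorm c <= 1.
Proof.
have [pi [/andP[p0 p1] piX]] := @abs_discrete R K.
exists (nanorm pi)^-1; first by rewrite invf_gt1.
move=> c; have [->|c0] := eqVneq c 0; first by rewrite nanorm0 ler01.
have [n ->] := piX c c0; case: n => n.
  by move=> _; rewrite -exprnP exprn_ile1// ltW.
rewrite NegzE -exprnN -exprVn exprS ltNge => /negP[].
by rewrite ler_peMr ?exprn_ege1 ?invf_ge1 ?invr_ge0 ?(ltW p0) ?(ltW p1).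
Qed.

(** The operator norm is only a supremum, so [d] is taken from a vector [T v] within a factor [q] of
    it. On the unit ball [d^-1 *: T] then takes norms below [q], hence at most 1 by the gap, and
    norm 1 at [v]. *)
Lemma exists_scaled_norm1 T : T != 0 -> exists c : K, nanorm (c *: T) = 1.
Proof.
move=> T0; have [q q1 gap] := nanormK_gap.
have q0 : 0 < q by exact: lt_trans q1.
have nT0 : 0 < nanorm T by rewrite lt0r nanorm_eq0 T0 nanorm_ge0.
have : nanorm T / q < nanorm T by rewrite ltr_pdivrMr// ltr_pMr.
rewrite {2}nanorm_cont_endE => /(sup_gt (opset_has_sup T).1).
move=> [_ [v /= v1 <-] Tv].
have [d dE] := strictly_cartesian (T v).
have nd0 : 0 < nanorm d by rewrite -dE (le_lt_trans _ Tv)// divr_ge0 ?ltW.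
have d0 : d != 0 by rewrite -nanorm_eq0 gt_eqF.
exists d^-1; apply/le_anti/andP; split.
  rewrite nanorm_cont_endE; apply: opnorm_lub => w w1.
  have [c cE] := strictly_cartesian ((d^-1 *: T) w).
  rewrite cE; apply: gap; rewrite -cE cont_end_valZ scale_lfunE nanormZ.
  rewrite nanormKV// ltr_pdivrMl// -dE.
  apply: le_lt_trans (opnorm_le1 T w1) _; move: Tv.
  by rewrite ltr_pdivrMr.
rewrite nanorm_cont_endE; apply: le_trans (opnorm_le1 _ v1).
by rewrite cont_end_valZ scale_lfunE nanormZ nanormKV// dE mulVf// gt_eqF.
Qed.

End NormalizedOperator.

(** * Semiprimeness of the image of the group algebra *)

Section Representation.
Context {R : realType} {k : localFieldType R} {M : topMonoidType}.

Section Semiprime.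
Context {V : cartFinBanachType k} (rho : unitary_rep M V).
Hypothesis red_semisimple : semisimple_ring (reduction (image_closure rho)).
Local Open Scope classical_set_scope.

Lemma range_rep_ext_closure (T : cont_end V) :
  range (rep_ext rho) T -> T \in in_image_closure rho.
Proof.
move=> rT; apply/in_image_closureP => e e0.
by exists T => //; rewrite subrr nanorm0.
Qed.

Lemma range_rep_extZ c (T : cont_end V) :
  range (rep_ext rho) T -> range (rep_ext rho) (c *: T).
Proof.
by move=> rT; rewrite -[c *: T]addr0; apply: range_rep_extDZ => //;
  exact: range_rep_ext0.
Qed.

Lemma image_closure_semiprime (S : cont_end V) :
    S \in in_image_closure rho -> nanorm S = 1 ->
  exists2 T, T \in in_image_closure rho & S * T * S != 0.
Proof.
move=> rS S1.
have [b aba] := @reduction_semiprime _ (image_closure rho) (ImageClosure rS)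
  red_semisimple S1.
exists b; first exact: image_closureP.
by apply: contraNneq aba => SbS; apply/eqP/val_inj; exact: SbS.
Qed.

(** Multiplying on both sides by the norm 1 operator [S'] does not increase norms, so an
    approximation [U] closer to [T] than the norm of [S' T S'] keeps the product nonzero. *)
Lemma range_rep_ext_semiprime (S : cont_end V) :
    range (rep_ext rho) S -> S != 0 ->
  exists2 T, range (rep_ext rho) T & S * T * S != 0.
Proof.
move=> rS S0; have [c cS1] := exists_scaled_norm1 S0.
set S' := c *: S in cS1.
have rS' : range (rep_ext rho) S' by exact: range_rep_extZ.
have [T rT STS] := image_closure_semiprime (range_rep_ext_closure rS') cS1.
have nSTS : 0 < nanorm (S' * T * S') by rewrite lt0r nanorm_eq0 STS nanorm_ge0.
have [U rU TU] := in_image_closureP _ _ rT _ nSTS.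
exists U => //; apply: contraTneq nSTS => SUS.
have SUS' : S' * U * S' = 0.
  have -> : S' * U * S' = c *: (c *: (S * U * S)).
    by apply: val_inj; rewrite /= -comp_lfunZr -!comp_lfunZl.
  by rewrite SUS !scaler0.
rewrite -leNgt; apply: contraTT TU; rewrite -ltNge -leNgt => _.
have -> : S' * T * S' = S' * (T - U) * S'.
  by rewrite mulrBr mulrBl SUS' subr0.
apply: le_trans (nanormM_le _ _) _; rewrite cS1 mulr1.
by apply: le_trans (nanormM_le _ _) _; rewrite cS1 mul1r.
Qed.

End Semiprime.

(** * Direct sums of irreducible subrepresentations *)

Lemma subrep_add (V : finBanachType k) (rho : unitary_rep M V) U W :
  subrep rho U -> subrep rho W -> subrep rho (U + W)%VS.
Proof. by move=> Us Ws m; rewrite limgD addvS. Qed.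

Lemma subrep_cap (V : finBanachType k) (rho : unitary_rep M V) U W :
  subrep rho U -> subrep rho W -> subrep rho (U :&: W)%VS.
Proof.
move=> Us Ws m; rewrite subv_cap.
rewrite (subv_trans (limgS _ (capvSl _ _)))//.
by rewrite (subv_trans (limgS _ (capvSr _ _))).
Qed.

(** Greedy construction: an irreducible not contained in the current sum meets it trivially, so it
    extends the direct sum, and the hypothesis supplies one until the sum is everything. *)
Lemma semisimple_rep_of_generation (V : finBanachType k)
    (rho : unitary_rep M V) :
  (forall U, subrep rho U ->
     (forall W, irreducible_subrep rho W -> (W <= U)%VS) -> U = fullv) ->
  semisimple_rep rho.
Proof.
move=> gen.
(* [c] bounds the codimension of the sum, and the equality of dimensions expresses directness.
   Indexing by [nat] lets a new member be placed at index [n]. *)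
suff H c n (W : nat -> {vspace V}) :
    (\dim {:V} <= c + \dim (\sum_(i < n) W i)%VS)%N ->
    (forall i, (i < n)%N -> irreducible_subrep rho (W i)) ->
    \dim (\sum_(i < n) W i)%VS = (\sum_(i < n) \dim (W i))%N ->
    semisimple_rep rho.
  by apply: (H (\dim {:V}) 0%N (fun=> 0%VS)); rewrite ?leq_addr ?big_ord0 ?dimv0.
elim: c n W => [|c IHc] n W dc Wirr dW;
  set U := (\sum_(i < n) W i)%VS in dc dW *.
  exists n, (fun i => W i); split=> [i||]; first exact: Wirr.
    by rewrite directvE /= -/U dW.
  by apply/eqP; rewrite eqEdim subvf.
have Usub : subrep rho U.
  rewrite /U; elim: (n) Wirr => [|p IHp] Wirr.
    by move=> m; rewrite big_ord0 limg0.
  rewrite big_ord_recr /=; apply: subrep_add; last by have [] := Wirr _ (ltnSn p).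
  by apply: IHp => i ip; apply: Wirr; exact: ltnW.
have [Ufull|Uproper] := eqVneq U fullv.
  by apply: (IHc n W) => //; rewrite -/U Ufull leq_addl.
have [W' W'irr W'U] : exists2 W', irreducible_subrep rho W' & ~~ (W' <= U)%VS.
  apply: contrapT => h; case/eqP: Uproper; apply: gen => // W' W'irr.
  by apply: contrapT => /negP W'U; apply: h; exists W'.
have [W's W'0 W'min] := W'irr.
have UW' : (U :&: W')%VS = 0%VS.
  have [//|UW'] := W'min _ (subrep_cap Usub W's) (capvSr _ _).
  by case/negP: W'U; rewrite -UW' capvSl.
pose Z i := if (i < n)%N then W i else W'.
have ZE : (\sum_(i < n) Z i = U)%VS by apply: eq_bigr => i _; rewrite /Z ltn_ord.
have Zn : Z n = W' by rewrite /Z ltnn.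
have dZ : \dim (\sum_(i < n.+1) Z i)%VS = (\dim U + \dim W')%N.
  by rewrite big_ord_recr /= ZE Zn dimv_disjoint_sum.
apply: (IHc n.+1 Z).
- rewrite dZ; apply: leq_trans dc _; rewrite addSnnS leq_add2l -addn1 leq_add2l.
  by rewrite lt0n dimv_eq0.
- move=> i; rewrite /Z; case: ifP => [/Wirr//|_ _]; exact: W'irr.
- rewrite dZ big_ord_recr /= Zn dW; congr addn.
  by apply: eq_bigr => i _; rewrite /Z ltn_ord.
Qed.

End Representation.

Theorem theorem4p1 (R : realType) (k : localFieldType R) (M : topMonoidType)
    (V : cartFinBanachType k) (rho : unitary_rep M V) :
  semisimple_ring (reduction (image_closure rho)) -> semisimple_rep rho.
Proof.
(* [A] is the image of k[M] itself, before taking the closure. *)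
move=> ss; have [A AP] : exists A : {vspace 'End(V)}, forall T, T \in A <->
    exists2 S, range (rep_ext rho) S & T = cont_end_val S.
  apply: vspace_of_pred => [|c _ _ [S rS ->] [T rT ->]].
    by exists 0; [exact: range_rep_ext0|rewrite cont_end_val0].
  exists (c *: S + T); first exact: range_rep_extDZ.
  by rewrite cont_end_valD cont_end_valZ.
have rhoA m : rho m \in A.
  by apply/AP; exists (rep_cont rho m) => //; exact: range_rep_ext_cont.
have A1 : \1%VF \in A by rewrite -(rep1 rho).
have AM a b : a \in A -> b \in A -> (a \o b)%VF \in A.
  move=> /AP[S rS ->] /AP[T rT ->]; apply/AP.
  by exists (S * T) => //; exact: range_rep_extM.
have Asp a : a \in A -> a != 0 -> exists2 b, b \in A & (a \o (b \o a))%VF != 0.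
  move=> /AP[S rS ->] vS0.
  have S0 : S != 0 by apply: contraNneq vS0 => ->; rewrite cont_end_val0.
  have [T rT STS] := range_rep_ext_semiprime ss rS S0.
  exists (cont_end_val T); first by apply/AP; exists T.
  by apply: contraNneq STS => e; apply/eqP/val_inj; rewrite /= -comp_lfunA.
(* The operators [rho m] span [A], so both notions of stability agree, and with them irreducibility
   and simplicity. *)
have stableP U : subrep rho U <-> stable_under A U.
  split=> [Us a u /AP[_ [f _ <-] ->] uU|Us m].
    apply: (big_ind (fun S : cont_end V => S u \in U)) => [|S T Su Tu|m _].
    - by rewrite cont_end_val0 zero_lfunE mem0v.
    - by rewrite cont_end_valD add_lfunE memvD.
    - rewrite cont_end_valZ scale_lfunE memvZ//.
      exact: subvP (Us m) _ (memv_img _ uU).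
  by apply/subvP => _ /memv_imgP[u uU ->]; exact: Us.
apply: semisimple_rep_of_generation => U /stableP Ust Uirr.
apply: (stable_containing_simples A1 AM Asp Ust) => W [Wst W0 Wmin].
by apply: Uirr; split=> // [|T /stableP]; [exact/stableP|exact: Wmin].
Qed.
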